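(* Let $\Gamma=(X,R)$ be a bipartite distance-regular graph with even diameter $D\ge4$ and valency $k\ge3$, let $d=D/2$, fix $x\in X$, let $W$ be a thin irreducible $T(x)$-module with endpoint $2$ and local eigenvalue $\tilde\theta_d$, and let $v$ be a nonzero vector in $E^*_2W$. Then for $0\le i\le D-3$, $$E^*_{i+2}A_iv=\sum_{\substack{j=1\\ j\ne d}}^{D-1}g_i(\theta_j)E_jv,\qquad\text{where}\qquad g_i=\sum_{\substack{h=0\\ i-h\ \text{even}}}^{i}\frac{P_h(0)}{P_i(0)}\,\frac{k_ib_ib_{i+1}}{k_hb_hb_{h+1}}\,p_h.$$
   Context: $\Gamma$ is a finite connected bipartite distance-regular graph with distance $\partial$, intersection numbers $c_i,b_i$ ($c_0=0,b_D=0$), $k_i=b_0\cdots b_{i-1}/(c_1\cdots c_i)$. $A_i$ distance matrices, $A=A_1$, eigenvalues $\theta_0>\dots>\theta_D$, $E_i$ the primitive idempotent of $A$ for $\theta_i$. $E^*_i$ is diagonal with $(y,y)$-entry $1$ if $\partial(x,y)=i$, else $0$; $T(x)$ is generated by $A,E^*_0,\dots,E^*_D$; thin: $\dim E^*_iW\le1$ for all $i$; endpoint $\min\{i:E^*_iW\ne0\}$; local eigenvalue of a thin irreducible $W$ with endpoint 2: eigenvalue of $E^*_2A_2E^*_2$ on $E^*_2W$. $\tilde\theta_d=-1-b_2b_3(\theta_d^2-b_2)^{-1}$. Polynomials: $f_0=1,f_{-1}=0$, $\lambda f_i=b_{i-1}f_{i-1}+c_{i+1}f_{i+1}$; $p_i=f_i+f_{i-2}+\cdots$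 (ending in $f_0$ or $f_1$ according to parity); $p_i(\lambda)=P_i(\lambda^2)$ for even $i$, $p_i(\lambda)=\lambda P_i(\lambda^2)$ for odd $i$. *)

(* Defs.v *)
From HB Require Import structures.
From mathcomp Require Import all_boot all_order all_algebra.

Set Implicit Arguments.
Unset Strict Implicit.
Unset Printing Implicit Defensive.

Import Order.TTheory GRing.Theory Num.Theory.
Local Open Scope ring_scope.

Section Graph.
Variables (X : finType) (adj : rel X).
Implicit Types y z : X.

Definition walk (n : nat) y z : bool :=
  [exists p : n.-tuple X, path adj y p && (last y p == z)].

(* Least length of a walk from y to z; a shortest walk has fewer than #|X|
   edges, and the value is #|X| when there is no walk at all. *)
Definition dist y z : nat := find (fun n => walk n y z) (iota 0 #|X|).

Definition diameter : nat := (\max_(y : X) \max_(z : X) dist y z)%N.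

Definition pcount (i j : nat) y z : nat :=
  #|[set w | (dist y w == i) && (dist z w == j)]|.

Definition connected : Prop := forall y z, connect adj y z.

Definition bipartite : Prop :=
  exists color : X -> bool, forall y z, adj y z -> color y != color z.

Definition distance_regular : Prop :=
  forall (i j : nat) y z y' z',
    dist y z = dist y' z' -> pcount i j y z = pcount i j y' z'.

Definition bipartite_distance_regular_graph : Prop :=
  [/\ symmetric adj, irreflexive adj, connected, bipartite & distance_regular].

(* p^h_(i,j), read off from some pair of vertices at distance h (0 if there is
   none); independent of that pair when the graph is distance-regular. *)
Definition pnum (h i j : nat) : nat :=
  if [pick yz : X * X | dist yz.1 yz.2 == h] is Some yz
  then pcount i j yz.1 yz.2 else 0%N.

(* For i = 0 this counts the w with dist y w = 1 and dist y w = 0, so it is 0. *)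
Definition cnum (i : nat) : nat := pnum i 1 i.-1.
Definition bnum (i : nat) : nat := pnum i 1 i.+1.
Definition valency : nat := bnum 0.

End Graph.

Section Terwilliger.
(* C is any algebraically closed field with a conjugation, such as the field of
   complex numbers; the standard module is the space of column vectors over C
   indexed by the vertices, through the enumeration of X. *)
Variables (C : numClosedFieldType) (X : finType) (adj : rel X).

Local Notation D := (diameter adj).
Local Notation b i := ((bnum adj i)%:R : C).
Local Notation c i := ((cnum adj i)%:R : C).
Local Notation MX := 'M[C]_#|X|.
Local Notation VX := 'cV[C]_#|X|.

Definition distmx (i : nat) : MX :=
  \matrix_(r, s) (dist adj (enum_val r) (enum_val s) == i)%:R.

Definition Estar (x : X) (i : nat) : MX :=
  \matrix_(r, s) ((r == s) && (dist adj x (enum_val r) == i))%:R.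

Definition ordered_eigenvalues (theta : nat -> C) : Prop :=
  (forall i j : nat, (i < j <= D)%N -> theta j < theta i) /\
  (forall a : C, eigenvalue (distmx 1) a <-> exists2 i, (i <= D)%N & theta i = a).

Definition bose_mesner (B : MX) : Prop :=
  exists a : nat -> C, B = \sum_(i < D.+1) a i *: distmx i.

Definition primitive_idempotent (e : MX) : Prop :=
  [/\ bose_mesner e, e != 0, e *m e = e
    & forall f : MX, bose_mesner f -> f *m f = f -> f *m e = f ->
        f = 0 \/ f = e].

Definition primitive_idempotent_for (a : C) (e : MX) : Prop :=
  primitive_idempotent e /\ distmx 1 *m e = a *: e.

Inductive terwilliger_algebra (x : X) : MX -> Prop :=
| Talg_one : terwilliger_algebra x 1%:M
| Talg_adj : terwilliger_algebra x (distmx 1)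
| Talg_Estar i of (i <= D)%N : terwilliger_algebra x (Estar x i)
| Talg_add B B' of terwilliger_algebra x B & terwilliger_algebra x B' :
    terwilliger_algebra x (B + B')
| Talg_scale (a : C) B of terwilliger_algebra x B :
    terwilliger_algebra x (a *: B)
| Talg_mul B B' of terwilliger_algebra x B & terwilliger_algebra x B' :
    terwilliger_algebra x (B *m B').

Definition Tmodule (x : X) (W : {vspace VX}) : Prop :=
  forall B, terwilliger_algebra x B -> forall w, w \in W -> B *m w \in W.

Definition irreducible_Tmodule (x : X) (W : {vspace VX}) : Prop :=
  [/\ Tmodule x W, W != 0%VS
    & forall U : {vspace VX}, Tmodule x U -> (U <= W)%VS ->
        U = 0%VS \/ U = W].

Definition EstarW (x : X) (i : nat) (W : {vspace VX}) : {vspace VX} :=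
  (linfun (mulmx (Estar x i)) @: W)%VS.

Definition thin (x : X) (W : {vspace VX}) : Prop :=
  forall i : nat, (i <= D)%N -> (\dim (EstarW x i W) <= 1)%N.

Definition endpoint (x : X) (W : {vspace VX}) : nat :=
  find (fun i => EstarW x i W != 0%VS) (iota 0 D.+1).

(* For thin W with endpoint 2 the space EstarW x 2 W is a line, so that there
   is exactly one such eta. *)
Definition local_eigenvalue (x : X) (W : {vspace VX}) (eta : C) : Prop :=
  exists w : VX, [/\ w \in EstarW x 2 W, w != 0
    & Estar x 2 *m distmx 2 *m Estar x 2 *m w = eta *: w].

Definition theta_tilde (a : C) : C := -1 - b 2 * b 3 * (a ^+ 2 - b 2)^-1.

Definition knum (i : nat) : C :=
  (\prod_(0 <= h < i) b h) / (\prod_(1 <= h < i.+1) c h).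

Fixpoint fpoly (i : nat) : {poly C} :=
  match i with
  | 0 => 1
  | j.+1 => (c j.+1)^-1 *:
      ('X * fpoly j - (if j is h.+1 then b h *: fpoly h else 0))
  end.

Definition ppoly (i : nat) : {poly C} :=
  \sum_(h < i.+1 | ~~ odd (i - h)) fpoly h.

(* The polynomial P_i with p_i = P_i(X^2) or p_i = X P_i(X^2); see ppoly_even
   and ppoly_odd below. *)
Definition Ppoly (i : nat) : {poly C} :=
  if odd i then odd_poly (ppoly i) else even_poly (ppoly i).

Definition gpoly (i : nat) : {poly C} :=
  \sum_(h < i.+1 | ~~ odd (i - h))
    ((Ppoly h).[0] / (Ppoly i).[0]
     * ((knum i * b i * b i.+1) / (knum h * b h * b h.+1))) *: ppoly h.

Lemma fpoly_parity i :
  (if odd i then even_poly (fpoly i) else odd_poly (fpoly i)) = 0.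
Proof.
suff [] : (if odd i then even_poly (fpoly i) else odd_poly (fpoly i)) = 0 /\
  (if odd i.+1 then even_poly (fpoly i.+1) else odd_poly (fpoly i.+1)) = 0 by [].
elim: i => [|i [IH1 IH2]]; first split.
- exact: odd_polyC.
- by rewrite /= subr0 mulr1 even_polyZ -[X in even_poly X]mul1r even_polyMX
    odd_polyC mul0r scaler0.
split=> //; move: IH1 IH2.
rewrite [fpoly i.+2]/= -/(fpoly i.+1) [odd i.+2]/= negbK [odd i.+1]/=.
have evenB (p q : {poly C}) : even_poly (p - q) = even_poly p - even_poly q.
  by rewrite even_polyD -scaleN1r even_polyZ scaleN1r.
have oddB (p q : {poly C}) : odd_poly (p - q) = odd_poly p - odd_poly q.
  by rewrite odd_polyD -scaleN1r odd_polyZ scaleN1r.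
case: (odd i) => /= IH1 IH2.
- by rewrite mulrC even_polyZ evenB even_polyMX even_polyZ IH1 IH2
    mul0r scaler0 subr0 scaler0.
by rewrite mulrC odd_polyZ oddB odd_polyMX odd_polyZ IH1 IH2
  scaler0 subr0 scaler0.
Qed.

Lemma ppoly_even i : ~~ odd i -> ppoly i = Ppoly i \Po 'X^2.
Proof.
move=> oi; rewrite /Ppoly (negPf oi) -{1}[ppoly i]poly_even_odd.
suff -> : odd_poly (ppoly i) = 0 by rewrite comp_poly0 mul0r addr0.
rewrite /ppoly; apply: (big_ind (fun p => odd_poly p = 0)).
- exact: odd_polyC.
- by move=> p q p0 q0; rewrite odd_polyD p0 q0 addr0.
move=> h; rewrite oddB -1?ltnS // (negPf oi) /= => oh.
by have := fpoly_parity h; rewrite (negPf oh).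
Qed.

Lemma ppoly_odd i : odd i -> ppoly i = 'X * (Ppoly i \Po 'X^2).
Proof.
move=> oi; rewrite /Ppoly oi -{1}[ppoly i]poly_even_odd.
suff -> : even_poly (ppoly i) = 0 by rewrite comp_poly0 add0r mulrC.
rewrite /ppoly; apply: (big_ind (fun p => even_poly p = 0)).
- exact: even_polyC.
- by move=> p q p0 q0; rewrite even_polyD p0 q0 addr0.
move=> h; rewrite oddB -1?ltnS // oi /= negbK => oh.
by have := fpoly_parity h; rewrite oh.
Qed.

End Terwilliger.

Arguments distmx C {X} adj i.
Arguments Estar C {X} adj x i.

(* Main.v *)
(* Let v be as in the theorem.  Since p_i(A) is the sum of the A_h with h <= i
   and h = i mod 2, and since the entries of v sum to 0 (the endpoint is 2), the
   vector p_i(A)v is the sum of v_i = E*_(i+2) A_i v and u_i = E*_i p_i(A) v.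
   By thinness u_(i+2) is a multiple of v_i as long as v_i <> 0, and comparing
   components in the three term recurrence for the p_i(A) v determines the
   multiplier: u_(i+2) = gamma_i v_i and E*_(i+2) A v_(i+1) = beta_i v_i, with
   explicit gamma_i, beta_i in terms of the P_h(0).  The initial values come
   from theta_d = 0, which turns the local eigenvalue into b_3 - 1.  Hence
   v_i = g_i(A) v, because g_(i+2) = p_(i+2) - gamma_i g_i, and it remains to
   expand v in the E_j v.  Here E_0 v = E_D v = 0, since E_0 and E_D are
   multiples of the matrices with entries 1 and (-1)^dist.  Finally
   beta_(D-3) = 0 because P_D(0) = 0, so v_(D-2) = g_(D-2)(A) v vanishes; as
   g_(D-2)(0) <> 0 this gives E_d v = 0. *)
Require Import Defs.
From mathcomp Require Import all_boot all_order all_algebra.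
From mathcomp Require Import zify ring.

Set Implicit Arguments.
Unset Strict Implicit.
Unset Printing Implicit Defensive.

Import Order.TTheory GRing.Theory Num.Theory.
Local Open Scope ring_scope.

(** * Distance in a bipartite distance-regular graph *)

Section Distance.
Variables (X : finType) (adj : rel X).
Hypothesis graphP : bipartite_distance_regular_graph adj.
Implicit Types y z w : X.

Local Notation dist := (dist adj).
Local Notation D := (diameter adj).
Local Notation walk := (walk adj).

Let adj_sym : symmetric adj. Proof. by case: graphP. Qed.

Lemma walkP n y z :
  reflect (exists p, [/\ path adj y p, last y p = z & size p = n]) (walk n y z).
Proof.
apply: (iffP existsP) => [[p /andP [yp /eqP pz]]|[p [yp pz sp]]].
  by exists p; rewrite size_tuple.
by exists (tcast sp (in_tuple p)); rewrite val_tcast yp pz eqxx.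
Qed.

Lemma dist_walk y z : walk (dist y z) y z.
Proof.
have [_ _ conn _ _] := graphP.
case/connectP: (conn y z) => p yp pz.
case: (shortenP yp) pz => q yq uq _ qz.
have sq : (size q < #|X|)%N.
  by rewrite -[(size q).+1]/(size (y :: q)) -(card_uniqP uq) max_card.
have h : has (fun n => walk n y z) (iota 0 #|X|).
  by apply/hasP; exists (size q); [rewrite mem_iota | apply/walkP; exists q].
rewrite /Defs.dist; have := nth_find 0%N h; rewrite nth_iota ?add0n //.
by move: h; rewrite has_find size_iota.
Qed.

Lemma dist_le n y z : walk n y z -> (dist y z <= n)%N.
Proof.
move=> wn; rewrite leqNgt; apply/negP => lt_n.
have := before_find 0%N lt_n; rewrite nth_iota ?add0n ?wn //.
by rewrite (leq_trans lt_n) // /Defs.dist -[X in (_ <= X)%N](size_iota 0) find_size.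
Qed.

Lemma walk_cat m n y w z : walk m y w -> walk n w z -> walk (m + n) y z.
Proof.
move=> /walkP [p [yp pw sp]] /walkP [q [wq qz sq]]; apply/walkP; exists (p ++ q).
by rewrite cat_path last_cat size_cat yp pw wq sp sq.
Qed.

Lemma walk1 y z : walk 1 y z = adj y z.
Proof.
apply/walkP/idP => [[[|u [|? ?]] [/= yu uz sz]]|yz] //.
  by rewrite -uz; case/andP: yu.
by exists [:: z]; rewrite /= yz.
Qed.

Lemma walk_sym n y z : walk n y z -> walk n z y.
Proof.
elim: n y z => [|n IH] y z /walkP [[|u p] []] //=.
  by move=> _ -> _; apply/walkP; exists [::].
move=> /andP [yu up] pz [sp].
rewrite -addn1; apply: (@walk_cat _ _ _ u); last by rewrite walk1 adj_sym.
by apply: IH; apply/walkP; exists p.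
Qed.

Lemma dist_sym y z : dist y z = dist z y.
Proof.
by apply/eqP; rewrite eqn_leq !dist_le // walk_sym // dist_walk.
Qed.

Lemma dist_triangle w y z : (dist y z <= dist y w + dist w z)%N.
Proof. by apply/dist_le/walk_cat; apply: dist_walk. Qed.

Lemma dist_eq0 y z : (dist y z == 0%N) = (y == z).
Proof.
apply/eqP/eqP => [d0|->].
  by have := dist_walk y z; rewrite d0 => /walkP [[|u p] []].
by apply/eqP; rewrite -leqn0; apply/dist_le/walkP; exists [::].
Qed.

Lemma dist_eq1 y z : (dist y z == 1%N) = adj y z.
Proof.
have [_ irr _ _ _] := graphP; rewrite -walk1; apply/eqP/idP => [<-|a].
  exact: dist_walk.
apply/eqP; rewrite eqn_leq dist_le // lt0n dist_eq0.
by apply/eqP => yz; move: a; rewrite walk1 yz irr.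
Qed.

(** Each edge changes the colour, so the parity of a walk is fixed by the colours of its ends. *)
Lemma odd_dist w y z : odd (dist y z) = odd (dist y w) (+) odd (dist w z).
Proof.
have [_ _ _ [color colorP] _] := graphP.
have odd_walk n u t : walk n u t -> odd n = color u (+) color t.
  elim: n u => [|n IH] u /walkP [[|s p] []] //=; first by move=> _ ->; rewrite addbb.
  move=> /andP [us sp] pt [szp]; rewrite (IH s); last by apply/walkP; exists p.
  by have := colorP _ _ us; case: (color u); case: (color s); case: (color t).
rewrite !(odd_walk _ _ _ (dist_walk _ _)).
by case: (color y); case: (color w); case: (color z).
Qed.

Lemma dist_pred n y z : dist y z = n.+1 -> exists2 w, dist w z = 1%N & dist y w = n.
Proof.
move=> dn; have := dist_walk y z; rewrite dn => /walkP [p []].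
case/lastP: p => [//|p u]; rewrite rcons_path last_rcons size_rcons.
move=> /andP [yp pu] uz [sp]; rewrite uz in pu.
exists (last y p); first by apply/eqP; rewrite dist_eq1.
have le_n : (dist y (last y p) <= n)%N by apply/dist_le/walkP; exists p.
apply/eqP; rewrite eqn_leq le_n /= -ltnS -dn.
apply: leq_trans (dist_triangle (last y p) y z) _.
by move: pu; rewrite -dist_eq1 => /eqP ->; rewrite addn1.
Qed.

Lemma dist_diameter y z : (dist y z <= D)%N.
Proof.
apply: (@leq_trans (\max_t dist y t)%N); first exact: leq_bigmax_cond.
exact: (@leq_bigmax_cond _ xpredT (fun y => \max_t dist y t)%N).
Qed.

Lemma dist_attained (x0 : X) i : (i <= D)%N -> exists y z, dist y z = i.
Proof.
have X0 : (0 < #|X|)%N by apply/card_gt0P; exists x0.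
have [y yP] := bigop.eq_bigmax (fun y => \max_z dist y z)%N X0.
have [z zP] := bigop.eq_bigmax (dist y) X0.
rewrite /= -/(diameter adj) in yP.
move=> iD; exists y; rewrite -(subKn iD).
elim: (D - i)%N => [|m [t tP]]; first by exists z; rewrite subn0 yP zP.
case: (leqP D m) => Dm.
  by exists t; rewrite tP; lia.
have [w _ wP] : exists2 w, dist w t = 1%N & dist y w = (D - m.+1)%N.
  by apply: dist_pred; rewrite tP; lia.
by exists w.
Qed.

Lemma pnumE y z i j : pnum adj (dist y z) i j = pcount adj i j y z.
Proof.
have [_ _ _ _ drg] := graphP; rewrite /pnum.
case: pickP => [yz /eqP d|/(_ (y, z))]; last by rewrite /= eqxx.
exact: drg.
Qed.

Lemma pcount_bnum y z i :
  dist y z = i -> pcount adj 1 i.+1 y z = bnum adj i.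
Proof. by move=> <-; rewrite /bnum pnumE. Qed.

Lemma pcount_cnum y z i :
  dist y z = i -> pcount adj 1 i.-1 y z = cnum adj i.
Proof. by move=> <-; rewrite /cnum pnumE. Qed.

(** Parity excludes equal distances, which leaves one less or one more. The guard on the first case
    excludes the truncated predecessor of 0. *)
Lemma dist_neighbor w y z : dist y w = 1%N ->
  (dist z w == (dist y z).-1) && (0 < dist y z)%N || (dist z w == (dist y z).+1).
Proof.
move=> d1; have := odd_dist w y z; rewrite d1 (dist_sym w z) => od.
have := dist_triangle w y z; have := dist_triangle y w z.
rewrite (dist_sym w y) (dist_sym w z) d1.
case/boolP: (dist z w == dist y z) => [/eqP e|]; last by lia.
by move: od; rewrite e; case: odd.
Qed.

Lemma bc_valency i : (i <= D)%N -> (cnum adj i + bnum adj i)%N = valency adj.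
Proof.
case: (boolP [exists y : X, true]) => [/existsP [x0 _]|/existsPn h].
  move=> /(dist_attained x0) [y [z <-]].
  have d0 : dist y y = 0%N by apply/eqP; rewrite dist_eq0.
  rewrite /valency /cnum /bnum -d0 !pnumE /pcount -cardsUI.
  rewrite [X in (_ + X)%N](_ : _ = 0%N) ?addn0; last first.
    apply/eqP; rewrite cards_eq0; apply/eqP/setP => w; rewrite !inE.
    by apply/negP => /andP [/andP [_ /eqP ->] /andP [_]]; lia.
  apply: eq_card => w; rewrite !inE d0 andbb -andb_orr.
  case: eqP => //= d1; have := dist_neighbor z d1.
  by case: eqP.
(* With no vertices at all, every [pnum] takes its default value 0. *)
have e j : [pick yz : X * X | dist yz.1 yz.2 == j] = None.
  by case: pickP => // yz; have := h yz.1.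
by rewrite /valency /cnum /bnum /pnum !e.
Qed.

Lemma bnum_gt0 (x0 : X) i : (i < D)%N -> (0 < bnum adj i)%N.
Proof.
move=> /(dist_attained x0) [y [z d]]; have [w d1 dw] := dist_pred d.
rewrite /bnum -{1}dw (dist_sym y w) pnumE /pcount; apply/card_gt0P; exists z.
by rewrite inE d1 d !eqxx.
Qed.

Lemma cnum_gt0 (x0 : X) i : (0 < i <= D)%N -> (0 < cnum adj i)%N.
Proof.
case: i => // i /(dist_attained x0) [y [z d]]; have [w d1 dw] := dist_pred d.
rewrite /cnum -{1}d (dist_sym y z) pnumE /pcount; apply/card_gt0P; exists w.
by rewrite inE (dist_sym z w) d1 dw !eqxx.
Qed.

Lemma bnum_diameter (x0 : X) : bnum adj D = 0%N.
Proof.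
have [y [z d]] := dist_attained x0 (leqnn D).
rewrite /bnum -{1}d pnumE /pcount; apply/eqP; rewrite cards_eq0; apply/eqP/setP => w.
rewrite !inE; apply/negP => /andP [_ /eqP].
by have := dist_diameter z w; lia.
Qed.

Lemma cnum0 (x0 : X) : cnum adj 0 = 0%N.
Proof.
have d0 : dist x0 x0 = 0%N by apply/eqP; rewrite dist_eq0.
rewrite /cnum -d0 pnumE d0 /pcount; apply/eqP; rewrite cards_eq0; apply/eqP/setP => w.
by rewrite !inE; apply/negP => /andP [/eqP ->].
Qed.

Lemma cnum1 (x0 : X) : (0 < D)%N -> cnum adj 1 = 1%N.
Proof.
move=> /(dist_attained x0) [y [z d]].
rewrite /cnum -{1}d pnumE /pcount; apply: etrans (cards1 z); apply: eq_card => w.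
rewrite !inE /= dist_eq0 [in RHS]eq_sym andbC.
by case: (z =P w) => // <-; rewrite d.
Qed.

End Distance.

(** * Sums over indices of equal parity *)

Section ParitySum.
Variables (K : comNzRingType) (M : lmodType K) (a : nat -> M).

Definition parity_sum (i : nat) : M := \sum_(h < i.+1 | ~~ odd (i - h)) a h.

Lemma parity_sum0 : parity_sum 0 = a 0.
Proof. by rewrite /parity_sum big_mkcond big_ord1. Qed.

Lemma parity_sum1 : parity_sum 1 = a 1.
Proof.
by rewrite /parity_sum big_mkcond !big_ord_recr big_ord0 /= !add0r.
Qed.

Lemma parity_sumS i : parity_sum i.+2 = a i.+2 + parity_sum i.
Proof.
rewrite /parity_sum big_mkcond 2!big_ord_recr /= subnn subSnn /= addr0 addrC.
congr (_ + _); rewrite [RHS]big_mkcond; apply: eq_bigr => h _.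
have hi : (h <= i)%N by rewrite -ltnS.
by rewrite !subSn ?leqW //= negbK.
Qed.

(* The inner terms of the sum collect the coefficient b (i - 1) + c (i + 1) of
   consecutive indices, hence the hypothesis that b i + c i is constant. *)
Lemma parity_sum_rec (T : M -> M) (b c : nat -> K) (k : K) (n : nat) :
  {morph T : u v / u + v} ->
  (forall i, (i <= n)%N -> c i + b i = k) -> c 0%N = 0 ->
  T (a 0%N) = c 1%N *: a 1%N ->
  (forall i, (i.+2 <= n)%N -> T (a i.+1) = c i.+2 *: a i.+2 + b i *: a i) ->
  forall i, (i.+2 <= n)%N ->
  T (parity_sum i.+1) = c i.+2 *: parity_sum i.+2 + b i.+2 *: parity_sum i.
Proof.
move=> TD bc c0 Ta0 TaS.
(* Below the top term every coefficient is the constant [k]; writing it as [c i.+2 + b i.+2] gives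
   the stated form. Two consecutive indices are carried because the sums grow in steps of two. *)
suff H i : ((i.+2 <= n)%N ->
    T (parity_sum i.+1) = c i.+2 *: a i.+2 + k *: parity_sum i) /\
  ((i.+3 <= n)%N ->
    T (parity_sum i.+2) = c i.+3 *: a i.+3 + k *: parity_sum i.+1).
  move=> i hi; have [/(_ hi) -> _] := H i.
  by rewrite -(bc i.+2) // parity_sumS scalerDr scalerDl addrA.
elim: i => [|i [IH1 IH2]]; split=> // hn.
- by rewrite parity_sum1 parity_sum0 TaS // -(bc 0%N) ?c0 ?add0r //; lia.
- rewrite parity_sumS parity_sum0 TD TaS // Ta0 parity_sum1 -(bc 1%N); last by lia.
  by rewrite scalerDl -addrA; congr (_ + _); rewrite addrC.
rewrite parity_sumS TD TaS // IH1; last by lia.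
rewrite [parity_sum i.+2]parity_sumS -{1}(bc i.+2); last by lia.
rewrite -addrA; congr (_ + _); rewrite addrA -scalerDl addrC.
by rewrite [b _ + _]addrC (bc i.+2) 1?scalerDr 1?addrC //; lia.
Qed.

End ParitySum.

(** * The Bose-Mesner algebra *)

Section BoseMesner.
Variables (C : numClosedFieldType) (X : finType) (adj : rel X).
Hypothesis graphP : bipartite_distance_regular_graph adj.
Variable x : X.

Local Notation D := (diameter adj).
Local Notation b i := ((bnum adj i)%:R : C).
Local Notation c i := ((cnum adj i)%:R : C).
Local Notation k := ((valency adj)%:R : C).
Local Notation A := (distmx C adj 1).
Local Notation A_ i := (distmx C adj i).
Local Notation N i := (parity_sum (distmx C adj) i).
Local Notation dst r s := (dist adj (enum_val r) (enum_val s)).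

Lemma natr_b_neq0 i : (i < D)%N -> b i != 0.
Proof. by move=> iD; rewrite pnatr_eq0 -lt0n (bnum_gt0 graphP x). Qed.

Lemma natr_c_neq0 i : (0 < i <= D)%N -> c i != 0.
Proof. by move=> iD; rewrite pnatr_eq0 -lt0n (cnum_gt0 graphP x). Qed.

Lemma natr_bc i : (i <= D)%N -> c i + b i = k.
Proof. by move=> iD; rewrite -natrD bc_valency. Qed.

Lemma natr_c0 : c 0 = 0.
Proof. by rewrite (cnum0 graphP x). Qed.

Lemma natr_bD : b D = 0.
Proof. by rewrite (bnum_diameter graphP x). Qed.

Lemma distmx_tr i : (A_ i)^T = A_ i.
Proof. by apply/matrixP=> r s; rewrite !mxE (dist_sym graphP). Qed.

Lemma distmx0 : A_ 0 = 1%:M.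
Proof.
by apply/matrixP=> r s; rewrite !mxE (dist_eq0 graphP) (inj_eq enum_val_inj).
Qed.

Lemma mul_distmxE i r s :
  (A *m A_ i) r s = (pcount adj 1 i (enum_val r) (enum_val s))%:R.
Proof.
rewrite mxE /pcount -sum1_card natr_sum.
rewrite (eq_bigl (fun w => (w \in X) && ((dist adj (enum_val r) w == 1%N) &&
   (dist adj (enum_val s) w == i)))); last by move=> w; rewrite !inE.
rewrite big_mkcondr [RHS]big_enum_val.
apply: eq_bigr => t _; rewrite !mxE (dist_sym graphP (enum_val s)).
by do 2![case: eqP => _]; rewrite ?(mul0r, mul1r, mulr0).
Qed.

Lemma pcount_eq0 i y z :
  dist adj y z != i.+1 -> (dist adj y z != i.-1) || (i == 0%N) ->
  pcount adj 1 i y z = 0%N.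
Proof.
move=> h1 h2; apply/eqP; rewrite cards_eq0; apply/eqP/setP => w; rewrite !inE.
apply/negP => /andP [/eqP d1 /eqP di].
by have := dist_neighbor graphP z d1; rewrite di; lia.
Qed.

Lemma mul_distmx0 : A *m A_ 0 = A.
Proof. by rewrite distmx0 mulmx1. Qed.

(** Along an edge the distance to a third vertex changes by exactly one, so the usual three term
    relation has no middle term. *)
Lemma mul_distmxS i : A *m A_ i.+1 = c i.+2 *: A_ i.+2 + b i *: A_ i.
Proof.
apply/matrixP=> r s; rewrite mul_distmxE !mxE.
have [e|n1] := eqVneq (dst r s) i.+2.
  rewrite (pcount_cnum graphP e) mulr1.
  by rewrite e (_ : (i.+2 == i) = false) ?mulr0 ?addr0 //; lia.
have [e|n2] := eqVneq (dst r s) i.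
  by rewrite (pcount_bnum graphP e) mulr0 mulr1 add0r.
by rewrite pcount_eq0 ?n1 //= ?n2 // !mulr0 addr0.
Qed.

Lemma mul_parity_distmx i : (i.+2 <= D)%N ->
  A *m N i.+1 = c i.+2 *: N i.+2 + b i.+2 *: N i.
Proof.
move: i; apply: (@parity_sum_rec _ _ _ (mulmx A) (fun i => b i) (fun i => c i) k).
- exact: mulmxDr.
- exact: natr_bc.
- exact: natr_c0.
- rewrite mul_distmx0; have [D0|D1] := posnP D.
    suff -> : A = 0 by rewrite scaler0.
    apply/matrixP=> r s; rewrite !mxE.
    by have := dist_diameter adj (enum_val r) (enum_val s); rewrite D0 leqn0 => /eqP ->.
  by rewrite (cnum1 graphP x) // scale1r.
by move=> i _; apply: mul_distmxS.
Qed.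

Lemma parity_distmxE i r s :
  (N i) r s = ((dst r s <= i)%N && ~~ odd (i - dst r s))%:R.
Proof.
set n := dst r s.
suff [] : (N i) r s = ((n <= i)%N && ~~ odd (i - n))%:R /\
  (N i.+1) r s = ((n <= i.+1)%N && ~~ odd (i.+1 - n))%:R by [].
elim: i => [|i [IH1 IH2]]; last split=> //.
  rewrite parity_sum0 parity_sum1 !mxE -/n.
  by case: n => [|[|n]].
rewrite parity_sumS mxE IH1 mxE -/n.
have [->|h] := eqVneq n i.+2; first by rewrite leqnn subnn -ltnS ltnNge leqnSn addr0.
rewrite add0r; congr (_ %:R); have [ni|ni] := leqP n i.
  by rewrite !subSn ?(leqW ni) ?(leqW (leqW ni)) //= negbK.
case: (leqP n i.+2) => //= n2.
by rewrite (_ : n = i.+1) ?subSnn //; lia.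
Qed.

(** By the three term relation [A *m A_ i] is symmetric, and symmetric matrices with a symmetric
    product commute. *)
Lemma distmx_comm i : A_ i *m A = A *m A_ i.
Proof.
case: i => [|i]; first by rewrite mul_distmx0 distmx0 mul1mx.
rewrite -[A_ i.+1 in LHS]distmx_tr -{1}[A]distmx_tr -trmx_mul mul_distmxS.
by rewrite linearD !linearZ /= !distmx_tr.
Qed.

Lemma bose_mesner_comm B : bose_mesner adj B -> B *m A = A *m B.
Proof.
move=> [a ->]; rewrite mulmx_suml mulmx_sumr; apply: eq_bigr => h _.
by rewrite -scalemxAl -scalemxAr distmx_comm.
Qed.

Lemma big_distmx (a : nat -> C) r s :
  (\sum_(i < D.+1) a i *: A_ i) r s = a (dst r s).
Proof.
have hd := dist_diameter adj (enum_val r) (enum_val s).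
rewrite summxE (bigD1 (Ordinal (hd : dst r s < D.+1)%N)) //= big1 => [|h hn].
  by rewrite !mxE eqxx mulr1 addr0.
by rewrite !mxE eq_sym (_ : (_ == _) = false) ?mulr0 //; apply/negbTE.
Qed.

Lemma degree (r : 'I_#|X|) : \sum_(s < #|X|) (dst r s == 1%N)%:R = k.
Proof.
have := mul_distmxE 1 r r; rewrite -{2}distmx_tr.
have d0 : dst r r = 0%N by apply/eqP; rewrite (dist_eq0 graphP).
rewrite (pcount_bnum graphP d0) -/(valency adj) => <-; rewrite !mxE.
apply: eq_bigr => s _; rewrite !mxE.
by case: eqP => _; rewrite ?mul0r ?mul1r.
Qed.

Definition parity_sign (r : 'I_#|X|) : C := (-1) ^+ dist adj x (enum_val r).

Lemma parity_sign_dist (r s : 'I_#|X|) :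
  (-1) ^+ dst r s = parity_sign r * parity_sign s.
Proof.
rewrite /parity_sign -exprD -signr_odd -[RHS]signr_odd oddD.
by rewrite (odd_dist graphP x) (dist_sym graphP _ x).
Qed.

Lemma parity_signK r : parity_sign r * parity_sign r = 1.
Proof. by rewrite /parity_sign -expr2 sqrr_sign. Qed.

(** Changing the sign of an eigenvector on one colour class negates its eigenvalue. *)
Lemma eigenvalue_opp (a : C) : eigenvalue A a -> eigenvalue A (- a).
Proof.
move=> /eigenvalueP [u uA u0]; apply/eigenvalueP.
exists (\row_s (u 0 s * parity_sign s)).
  apply/rowP=> s; have /rowP/(_ s) := uA; rewrite !mxE => uAs.
  rewrite mulNr mulrA -uAs mulr_suml -sumrN; apply: eq_bigr => r _; rewrite !mxE.
  have [d1|] := eqVneq (dst r s) 1%N; last by rewrite !mulr0 mul0r oppr0.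
  have := parity_sign_dist r s; rewrite d1 expr1 => h; rewrite !mulr1 -mulrN.
  by congr (_ * _); apply: (mulIf (x := parity_sign s)); [
     rewrite signr_eq0 | rewrite mulNr parity_signK -h].
apply: contraNneq u0 => /rowP h; apply/eqP/rowP=> s.
by have /eqP := h s; rewrite !mxE mulf_eq0 signr_eq0 orbF => /eqP.
Qed.

(** Taking 1-norms in [u *m A = a *: u] gives [|a|] times the norm of [u] on one side and at most
    [k] times it on the other. *)
Lemma eigenvalue_le_valency (a : C) : eigenvalue A a -> `|a| <= k.
Proof.
move=> /eigenvalueP [u uA u0].
have n_gt0 : 0 < \sum_s `|u 0 s|.
  have n_ge0 : 0 <= \sum_s `|u 0 s| by apply: sumr_ge0.
  rewrite lt_def n_ge0 andbT; apply: contraNneq u0 => /eqP.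
  rewrite psumr_eq0 // => /allP h; apply/eqP/rowP=> s.
  by rewrite mxE; apply/eqP; rewrite -normr_eq0; apply: h; rewrite mem_index_enum.
rewrite -(ler_pM2r n_gt0) !mulr_sumr.
apply: (@le_trans _ _ (\sum_s \sum_r `|u 0 r| * (dst r s == 1%N)%:R)).
  apply: ler_sum => s _; rewrite -normrM.
  have -> : a * u 0 s = \sum_r u 0 r * A r s.
    by have /rowP/(_ s) := uA; rewrite !mxE.
  apply: le_trans (ler_norm_sum _ _ _) _; apply: ler_sum => r _.
  by rewrite normrM !mxE normr_nat.
rewrite exchange_big /=; apply: ler_sum => r _.
by rewrite -mulr_sumr degree mulrC.
Qed.

End BoseMesner.

(** * Primitive idempotents *)

(** Negation reverses the order, so it exchanges the i-th largest and the i-th smallest value. The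
    index of [- t i] is bounded above by induction from the largest value and below by induction
    from the smallest. *)
Lemma decreasing_opp_symmetric (R : numDomainType) (n : nat) (t : nat -> R) :
  (forall i j : nat, (i < j <= n)%N -> t j < t i) ->
  (forall i, (i <= n)%N -> exists2 j, (j <= n)%N & t j = - t i) ->
  forall i, (i <= n)%N -> t (n - i)%N = - t i.
Proof.
move=> t_lt t_opp.
have lt_t i j : (i <= n)%N -> (j <= n)%N -> t i < t j -> (j < i)%N.
  move=> hi hj lt_ij; rewrite ltnNge leq_eqVlt; apply/negP => /orP [/eqP e|lt].
    by rewrite e ltxx in lt_ij.
  by have := t_lt i j; rewrite lt hj => /(_ isT); rewrite (lt_gtF lt_ij).
have le i j : (i <= n)%N -> (j <= n)%N -> t j = - t i -> (j <= n - i)%N.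
  elim: i j => [|i IH] j hi hj tj; first by rewrite subn0.
  have [j' hj' tj'] := t_opp i (ltnW hi).
  have := IH j' (ltnW hi) hj' tj'; suff : (j < j')%N by lia.
  by apply: lt_t => //; rewrite tj tj' ltrN2; apply: t_lt; rewrite leqnn.
have ge m i j : (n - i)%N = m -> (i <= n)%N -> (j <= n)%N -> t j = - t i ->
    (m <= j)%N.
  elim: m i j => [//|m IH] i j hm hi hj tj.
  have hi' : (i < n)%N by lia.
  have [j' hj' tj'] := t_opp i.+1 hi'.
  apply: leq_ltn_trans (IH i.+1 j' _ hi' hj' tj') _; first by lia.
  by apply: lt_t => //; rewrite tj tj' ltrN2; apply: t_lt; rewrite leqnn.
move=> i hi; have [j hj tj] := t_opp i hi.
suff -> : (n - i)%N = j by [].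
by apply/eqP; rewrite eqn_leq (ge _ i) // le.
Qed.

Section Idempotents.
Variables (C : numClosedFieldType) (X : finType) (adj : rel X).
Hypothesis graphP : bipartite_distance_regular_graph adj.
Variable x : X.

Local Notation D := (diameter adj).
Local Notation b i := ((bnum adj i)%:R : C).
Local Notation c i := ((cnum adj i)%:R : C).
Local Notation k := ((valency adj)%:R : C).
Local Notation A := (distmx C adj 1).
Local Notation A_ i := (distmx C adj i).
Local Notation N i := (parity_sum (distmx C adj) i).
Local Notation dst r s := (dist adj (enum_val r) (enum_val s)).

Variables (theta : nat -> C) (E : nat -> 'M[C]_#|X|).
Hypothesis theta_eig : ordered_eigenvalues adj theta.
Hypothesis E_prim :
  forall i : nat, (i <= D)%N -> primitive_idempotent_for adj (theta i) (E i).

Lemma theta_eq i j : (i <= D)%N -> (j <= D)%N -> (theta i == theta j) = (i == j).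
Proof.
move=> hi hj; have [lt _] := theta_eig; apply/eqP/eqP => [e|-> //].
by case: (ltngtP i j) => // ij; have := lt _ _ (introT andP (conj ij _));
  rewrite e ltxx => h; have := h; rewrite ?hi ?hj => /(_ isT).
Qed.

Lemma mulAE j : (j <= D)%N -> A *m E j = theta j *: E j.
Proof. by case/E_prim. Qed.

Lemma E_bose_mesner j : (j <= D)%N -> bose_mesner adj (E j).
Proof. by case/E_prim => [[]]. Qed.

Lemma mul_eigen_E (f : 'M[C]_#|X|) (a : C) j : (j <= D)%N ->
  f *m A = a *: f -> a != theta j -> f *m E j = 0.
Proof.
move=> hj fA na.
have : a *: (f *m E j) = theta j *: (f *m E j).
  by rewrite scalemxAl -fA -mulmxA mulAE // -scalemxAr.
by move/eqP; rewrite -subr_eq0 -scalerBl scaler_eq0 subr_eq0 (negbTE na) => /eqP.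
Qed.

Lemma mulEE i j : (i <= D)%N -> (j <= D)%N ->
  E i *m E j = if i == j then E j else 0.
Proof.
move=> hi hj; have [->|nij] := eqVneq i j.
  by have [[_ _ + _] _] := E_prim hj.
apply: (@mul_eigen_E _ (theta i)) => //; last by rewrite theta_eq.
by rewrite (bose_mesner_comm graphP) ?mulAE //; apply: E_bose_mesner.
Qed.

(* The D + 1 matrices E j are independent elements of the span of the D + 1
   distance matrices, so that the latter are combinations of the former. *)
Lemma sum_E : \sum_(j < D.+1) E j = 1%:M.
Proof.
have /fin_all_exists [q qP] : forall j : 'I_D.+1, exists a : nat -> C,
    E j = \sum_(i < D.+1) a i *: A_ i.
  by move=> j; apply: E_bose_mesner; rewrite -ltnS.
pose Q := \matrix_(j < D.+1, i < D.+1) q j i.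
have free : row_free Q.
  rewrite -kermx_eq0; apply/rowV0P => u /sub_kermxP uQ.
  have u0 : \sum_(j < D.+1) u 0 j *: E j = 0.
    transitivity (\sum_(j < D.+1) \sum_(i < D.+1) (u 0 j * q j i) *: A_ i).
      apply: eq_bigr => j _; rewrite qP scaler_sumr.
      by apply: eq_bigr => i _; rewrite scalerA.
    rewrite exchange_big big1 //= => i _; rewrite -scaler_suml.
    have /rowP/(_ i) := uQ; rewrite !mxE => h.
    rewrite (_ : \sum_j _ = 0) ?scale0r // -[RHS]h.
    by apply: eq_bigr => j _; rewrite mxE.
  apply/rowP=> l; rewrite mxE; apply/eqP.
  have hl : (l <= D)%N by rewrite -ltnS.
  have := congr1 (mulmxr (E l)) u0; rewrite /= mul0mx mulmx_suml (bigD1 l) //=.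
  rewrite -scalemxAl mulEE // eqxx big1 ?addr0 => [/eqP|j nj].
    by rewrite scaler_eq0; have [[_ /negbTE -> _ _] _] := E_prim hl; rewrite orbF.
  by rewrite -scalemxAl mulEE // 1?(negbTE nj : (val j == val l) = false) ?scaler0 //
  -ltnS.
have Qu : Q \in unitmx by rewrite -row_free_unit.
pose a j := invmx Q 0 j.
have a1 : 1%:M = \sum_(j < D.+1) a j *: E j.
  (* Row 0 of [invmx Q] expresses [A_ 0], the identity, through the [E j]. *)
  rewrite -(distmx0 C graphP).
  transitivity (\sum_(i < D.+1) (invmx Q *m Q) 0 i *: A_ i).
    rewrite mulVmx // (bigD1 0) //= big1 => [|i ni].
      by rewrite !mxE eqxx scale1r addr0.
    by rewrite !mxE eq_sym (negbTE ni) scale0r.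
  transitivity (\sum_(i < D.+1) \sum_(j < D.+1) (a j * q j i) *: A_ i).
    apply: eq_bigr => i _; rewrite !mxE scaler_suml; apply: eq_bigr => j _.
    by rewrite !mxE.
  rewrite exchange_big /=; apply: eq_bigr => j _; rewrite qP scaler_sumr.
  by apply: eq_bigr => i _; rewrite scalerA.
(* Multiplying the expansion by [E l] gives [E l = a l *: E l], the equality of the terms of index
   [l]. *)
rewrite a1; apply: eq_bigr => l _; have hl : (l <= D)%N by rewrite -ltnS.
have := congr1 (mulmxr (E l)) a1; rewrite /= mul1mx mulmx_suml (bigD1 l) //=.
rewrite -scalemxAl mulEE // eqxx big1 ?addr0 // => j nj.
by rewrite -scalemxAl mulEE // 1?(negbTE nj : (val j == val l) = false) ?scaler0 //
  -ltnS.
Qed.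

(** [f] annihilates every other [E l], so [f = f *m E j]; primitivity of [E j] then forces the
    nonzero [f] to be [E j]. *)
Lemma idempotent_E (f : 'M[C]_#|X|) (a : C) j : (j <= D)%N ->
  bose_mesner adj f -> f != 0 -> f *m f = f -> A *m f = a *: f -> theta j = a ->
  E j = f.
Proof.
move=> hj f_bm f0 ff Af ja; have [[_ _ _ /(_ f f_bm ff) prim] _] := E_prim hj.
have [|e|//] := prim; last by rewrite e eqxx in f0.
rewrite -[RHS]mulmx1 -sum_E mulmx_sumr (bigD1 (Ordinal (hj : j < D.+1)%N)) //=.
rewrite big1 ?addr0 // => l nl; have hl : (l <= D)%N by rewrite -ltnS.
apply: (@mul_eigen_E _ a) => //; first by rewrite (bose_mesner_comm graphP).
by rewrite -ja theta_eq // eq_sym.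
Qed.

(** * The idempotents for the largest and the smallest eigenvalue *)

Section Character.
Variables (eps : C) (e : 'I_#|X| -> C).
Hypothesis eK : forall r, e r * e r = 1.
Hypothesis eps_dist : forall r s, eps ^+ dst r s = e r * e s.

(** The rank one projection onto [e], written in the distance matrices because it has to lie in the
    Bose-Mesner algebra. The cases used are [eps = 1] with constant [e], and [eps = -1] with
    [parity_sign]. *)
Definition character_mx : 'M[C]_#|X| :=
  (#|X|%:R)^-1 *: \sum_(i < D.+1) eps ^+ i *: A_ i.

Let X_neq0 : #|X|%:R != 0 :> C.
Proof. by rewrite pnatr_eq0 -lt0n; apply/card_gt0P; exists x. Qed.

Lemma character_mxE r s : character_mx r s = (#|X|%:R)^-1 * (e r * e s).
Proof. by rewrite mxE big_distmx eps_dist. Qed.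

Lemma mul_A_character : A *m character_mx = (eps * k) *: character_mx.
Proof.
apply/matrixP=> r s; rewrite mxE [RHS]mxE -(degree C graphP r).
rewrite mulr_sumr mulr_suml; apply: eq_bigr => t _.
rewrite !character_mxE !mxE; have [d1|] := eqVneq (dst r t) 1%N; last first.
  by rewrite mulr0 !mul0r.
have := eps_dist r t; rewrite d1 expr1 => ->.
rewrite mulr1 mul1r; transitivity (e r * e r * ((#|X|%:R)^-1 * (e t * e s))).
  by rewrite eK mul1r.
ring.
Qed.

Lemma character_mx_neq0 : character_mx != 0.
Proof.
apply/eqP => /matrixP h; have r : 'I_#|X| := enum_rank x.
have := h r r; rewrite character_mxE mxE eK mulr1 => /eqP.
by rewrite invr_eq0 (negbTE X_neq0).
Qed.

Lemma character_bose_mesner : bose_mesner adj character_mx.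
Proof.
exists (fun i => (#|X|%:R)^-1 * eps ^+ i).
by rewrite /character_mx scaler_sumr; apply: eq_bigr => i _; rewrite scalerA.
Qed.

Lemma character_mx_eigenvalue : eigenvalue A (eps * k).
Proof.
apply/eigenvalueP; exists (row (enum_rank x) character_mx).
  rewrite -row_mul (bose_mesner_comm graphP character_bose_mesner).
  by rewrite mul_A_character linearZ.
apply/eqP => /rowP /(_ (enum_rank x)); rewrite mxE character_mxE mxE eK mulr1.
by move/eqP; rewrite invr_eq0 (negbTE X_neq0).
Qed.

Lemma character_E j : (j <= D)%N -> theta j = eps * k -> E j = character_mx.
Proof.
move=> hj; apply: idempotent_E => //.
- exact: character_bose_mesner.
- exact: character_mx_neq0.
- apply/matrixP=> r s; rewrite mxE !character_mxE.
  rewrite (eq_bigr (fun _ => (#|X|%:R)^-1 * ((#|X|%:R)^-1 * (e r * e s)))) => [|t _].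
    by rewrite sumr_const card_ord -[_ *+ #|X|]mulr_natl mulrA divff // mul1r.
  rewrite !character_mxE.
  transitivity (e t * e t * ((#|X|%:R)^-1 * ((#|X|%:R)^-1 * (e r * e s)))); first ring.
  by rewrite eK mul1r.
exact: mul_A_character.
Qed.

End Character.

(** The spectrum is closed under negation and listed in decreasing order. For even [D] the middle
    eigenvalue is therefore 0. *)
Lemma theta_sub i : (i <= D)%N -> theta (D - i)%N = - theta i.
Proof.
have [lt eig] := theta_eig; apply: decreasing_opp_symmetric => // {}i hi.
by apply/eig/(eigenvalue_opp graphP x)/eig; exists i.
Qed.

(** The constant character has eigenvalue [k], and no eigenvalue exceeds [k] in modulus. *)
Lemma theta0 : theta 0 = k.
Proof.
have [lt eig] := theta_eig.
have /eig [j hj tj] : eigenvalue A k.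
  rewrite -[k]mul1r; apply: (@character_mx_eigenvalue _ (fun _ => 1)) => *.
    by rewrite mulr1.
  by rewrite expr1n mulr1.
have /eig/(eigenvalue_le_valency graphP) :
  exists2 i, (i <= D)%N & theta i = theta 0 by exists 0%N.
case: j hj tj => // j hj tj; have := lt 0%N j.+1; rewrite hj tj => /(_ isT) lt0.
rewrite ger0_norm => [le0|]; first by have := lt_le_trans lt0 le0; rewrite ltxx.
by apply: le_trans (ltW lt0); apply: ler0n.
Qed.

Lemma E0_mul (v : 'cV[C]_#|X|) : \sum_s v s 0 = 0 -> E 0 *m v = 0.
Proof.
move=> v0; apply/colP=> r; rewrite mxE mxE.
transitivity ((#|X|%:R)^-1 * \sum_s v s 0); last by rewrite v0 mulr0.
rewrite mulr_sumr; apply: eq_bigr => s _.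
rewrite (@character_E 1 (fun _ => 1)) ?theta0 ?mul1r //.
- by rewrite (@character_mxE _ (fun _ => 1)) /= ?mulr1 // => *; rewrite expr1n.
by move=> *; rewrite expr1n.
Qed.

(** Since [theta D = - k], every row of [E D] is a multiple of the vector of parity signs. *)
Lemma ED_mul (v : 'cV[C]_#|X|) :
  \sum_s parity_sign C adj x s * v s 0 = 0 -> E D *m v = 0.
Proof.
move=> v0; apply/colP=> r; rewrite mxE mxE.
transitivity ((#|X|%:R)^-1 * parity_sign C adj x r *
  \sum_s parity_sign C adj x s * v s 0); last by rewrite v0 mulr0.
rewrite mulr_sumr; apply: eq_bigr => s _.
rewrite (@character_E (-1) (parity_sign C adj x)) //.
- rewrite (@character_mxE _ (parity_sign C adj x)) ?mulrA // => *.
  exact: parity_sign_dist.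
- exact: parity_signK.
- by move=> *; apply: parity_sign_dist.
by have := theta_sub (leq0n D); rewrite subn0 theta0 mulN1r.
Qed.

Lemma fpolySS i : fpoly C adj i.+2 =
  (c i.+2)^-1 *: ('X * fpoly C adj i.+1 - b i *: fpoly C adj i).
Proof. by []. Qed.

(** [A_ m] acts on [E j] as the value of [fpoly m] at [theta j], because both satisfy the same
    recurrence. *)
Lemma mul_parity_E i j : (i <= D)%N -> (j <= D)%N ->
  N i *m E j = (ppoly C adj i).[theta j] *: E j.
Proof.
move=> hi hj.
have fE m : (m <= D)%N -> A_ m *m E j = (fpoly C adj m).[theta j] *: E j.
  suff [] : ((m <= D)%N -> A_ m *m E j = (fpoly C adj m).[theta j] *: E j) /\
    ((m.+1 <= D)%N -> A_ m.+1 *m E j = (fpoly C adj m.+1).[theta j] *: E j) by [].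
  elim: m => [|m [IH1 IH2]]; last split=> // hm.
    rewrite (distmx0 C graphP) mul1mx /= subr0 mulr1 !hornerE scale1r; split=> // h.
    by rewrite (cnum1 graphP x) // invr1 mul1r mulAE.
  have cn := natr_c_neq0 C graphP x (hm : 0 < m.+2 <= D)%N.
  have := congr1 (mulmxr (E j)) (mul_distmxS C graphP m).
  rewrite fpolySS [mulmxr _ _]/= [in RHS]/= -mulmxA IH2
    ?mulmxDl -?scalemxAl ?IH1 -?scalemxAr ?mulAE //; try lia.
  move=> /esym/(canRL (addrK _))/(canRL (scalerK cn)) ->.
  move: (fpoly C adj m.+1) (fpoly C adj m) => p q.
  rewrite !scalerA -scalerBl scalerA hornerZ hornerD hornerN hornerM hornerX hornerZ.
  by congr (_ *: _); ring.
rewrite /parity_sum mulmx_suml horner_sum scaler_suml; apply: eq_bigr => h _.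
by rewrite fE // (leq_trans _ hi) // -ltnS.
Qed.

End Idempotents.

(** * The coefficients gamma and beta *)

Section Coefficients.
Variables (C : numClosedFieldType) (X : finType) (adj : rel X).
Hypothesis graphP : bipartite_distance_regular_graph adj.
Variable x : X.

Local Notation D := (diameter adj).
Local Notation b i := ((bnum adj i)%:R : C).
Local Notation c i := ((cnum adj i)%:R : C).
Local Notation k := ((valency adj)%:R : C).
Local Notation p i := (ppoly C adj i).

Hypothesis D_ge4 : (4 <= D)%N.

Definition zval (i : nat) : C := (Ppoly C adj i).[0].
Local Notation z := zval.

Let b0 i : (i < D)%N -> b i != 0. Proof. exact: natr_b_neq0. Qed.
Let c0 i : (0 < i <= D)%N -> c i != 0. Proof. exact: natr_c_neq0. Qed.
Let b_gt0 i : (i < D)%N -> 0 < b i.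
Proof. by move=> hi; rewrite lt_def ler0n b0. Qed.
Let c_gt0 i : (0 < i <= D)%N -> 0 < c i.
Proof. by move=> hi; rewrite lt_def ler0n c0. Qed.
Let c1 : c 1 = 1. Proof. by rewrite (cnum1 graphP x) //; lia. Qed.

(** For odd [i] the factor X of [p_i] moves the constant term of [P_i] to degree 1. *)
Lemma zvalE i : z i = (p i)`_(odd i).
Proof.
rewrite /zval /Ppoly horner_coef0.
by case: (odd i); rewrite ?coef_odd_poly ?coef_even_poly.
Qed.

Lemma ppoly_rec i : (i.+2 <= D)%N ->
  'X * p i.+1 = c i.+2 *: p i.+2 + b i.+2 *: p i.
Proof.
move: i; apply: (@parity_sum_rec _ _ (fpoly C adj) ( *%R 'X)
  (fun i => b i) (fun i => c i) k).
- exact: mulrDr.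
- exact: natr_bc.
- exact: natr_c0.
- by rewrite /= subr0 c1 invr1 !scale1r.
move=> i hi; rewrite fpolySS.
by rewrite scalerA divff ?scale1r ?subrK // c0.
Qed.

Lemma zval0 : z 0 = 1.
Proof. by rewrite zvalE [p 0]parity_sum0 coefC. Qed.

Lemma zval1 : z 1 = 1.
Proof. by rewrite zvalE [p 1]parity_sum1 /= subr0 c1 invr1 scale1r mulr1 coefX. Qed.

(** Compares coefficients of degree 0 or 1 in [ppoly_rec]; for even [i] the product with X has no
    constant term. *)
Lemma zval_rec i : (i.+2 <= D)%N ->
  c i.+2 * z i.+2 + b i.+2 * z i = if odd i then z i.+1 else 0.
Proof.
move=> hi; rewrite !zvalE /= negbK.
have := congr1 (fun q : {poly C} => q`_(odd i)) (ppoly_rec hi).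
rewrite coefD !coefZ mulrC coefMX => <-.
by case: (odd i).
Qed.

(** The signs run +, +, -, -, and so on: solved for [z i.+2], the recurrence adds terms of one sign
    only. Hence the denominators [P_h(0)] with [h < D] are nonzero. *)
Lemma zval_sign i : (i < D)%N -> 0 < (-1) ^+ i./2 * z i.
Proof.
suff [] : ((i < D)%N -> 0 < (-1) ^+ i./2 * z i) /\
  ((i.+1 < D)%N -> 0 < (-1) ^+ i.+1./2 * z i.+1) by [].
elim: i => [|i [IH1 IH2]]; last split=> // hi.
  by rewrite zval0 zval1 /= !mulr1; split=> _; apply: ltr01.
have hc : 0 < c i.+2 by apply: c_gt0; lia.
have hb : 0 < b i.+2 by apply: b_gt0.
have z_i := IH1 (ltnW (ltnW hi)); have z_i1 := IH2 (ltnW hi).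
rewrite -(pmulr_rgt0 _ hc) mulrCA.
rewrite (canRL (addrK _) (zval_rec (ltnW hi))) /=.
have -> : (-1) ^+ (i./2).+1 * ((if odd i then z i.+1 else 0) - b i.+2 * z i) =
  (if odd i then (-1) ^+ i.+1./2 * z i.+1 else 0) +
  b i.+2 * ((-1) ^+ i./2 * z i) :> C.
  rewrite exprS -uphalfE uphalf_half; case: (odd i); last by ring.
  by rewrite add1n exprS; ring.
by case: (odd i); [apply: addr_gt0 | rewrite add0r]; rewrite // mulr_gt0.
Qed.

Lemma zval_neq0 i : (i < D)%N -> z i != 0.
Proof.
by move=> /zval_sign; apply: contraTneq => ->; rewrite mulr0 ltxx.
Qed.

(** At index [D] the recurrence loses its second term, as [b D = 0], and for even [D] its right side
    is 0. *)
Lemma zvalD : ~~ odd D -> z D = 0.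
Proof.
move=> oD; have e : (D - 2).+2 = D by lia.
have := @zval_rec (D - 2); rewrite e leqnn oddB ?(negbTE oD) /=; last by lia.
move=> /(_ isT) /eqP; rewrite (natr_bD C graphP x) mul0r addr0 mulf_eq0.
by rewrite (negbTE (c0 _)) => [/eqP|]; last by lia.
Qed.

Definition knumbb (i : nat) : C := knum C adj i * b i * b i.+1.

Lemma knumS i : knum C adj i.+1 = knum C adj i * (b i / c i.+1).
Proof.
rewrite /knum [in LHS]big_nat_recr //= [in LHS](@big_nat_recr _ _ _ i.+1) //=.
by rewrite invfM mulrACA.
Qed.

Lemma knum_gt0 i : (i <= D)%N -> 0 < knum C adj i.
Proof.
elim: i => [|i IH] hi; first by rewrite /knum !big_geq // divr1 ltr01.
by rewrite knumS mulr_gt0 ?IH ?(ltnW hi) ?divr_gt0 ?b_gt0 ?c_gt0.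
Qed.

Lemma knumbb_gt0 i : (i.+1 < D)%N -> 0 < knumbb i.
Proof.
by move=> hi; rewrite /knumbb 2?mulr_gt0 ?b_gt0 ?knum_gt0 //; lia.
Qed.

(* For u_i = E*_i p_i(A) v and v_i = E*_(i+2) A_i v one has
   u_(i+2) = gamma i * v_i, and beta i is the coefficient of v_i in A v_(i+1). *)
Definition gamma (i : nat) : C := - (z i / z i.+2 * (knumbb i.+2 / knumbb i)).

Definition beta (i : nat) : C :=
  z i * z i.+3 / (z i.+1 * z i.+2) * (b i.+2 * c i.+3 / c i.+1).

Lemma gammaE i : (i.+2 < D)%N ->
  gamma i = - (z i / z i.+2 * (b i.+2 * b i.+3 / (c i.+1 * c i.+2))).
Proof.
move=> hi; rewrite /gamma /knumbb !knumS; congr (- (_ * _)).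
have ki : knum C adj i != 0 by rewrite gt_eqF // knum_gt0 //; lia.
field; rewrite ?ki ?b0 ?c0 //; lia.
Qed.

Lemma gamma0 : gamma 0 = b 3.
Proof.
rewrite gammaE; last by lia.
have h2 : (2 <= D)%N by lia.
have := zval_rec h2; rewrite zval0 mulr1 /= c1 => /(canRL (addrK _)); rewrite add0r => e.
have -> : z 2 = - (b 2 / c 2).
  by apply: (mulfI (c0 _ : c 2 != 0)); [lia | rewrite e; field; apply: c0; lia].
by field; rewrite b0 ?c0; lia.
Qed.

Lemma beta0 : beta 0 = b 2 + c 2 * b 3.
Proof.
have h2 : (2 <= D)%N by lia.
have h3 : (3 <= D)%N by lia.
have z2 : z 2 != 0 by apply: zval_neq0; lia.
have := zval_rec h3; have := zval_rec h2; rewrite zval0 zval1 /= !mulr1.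
move=> /(canRL (addrK _)) e2 /(canRL (addrK _)) e3.
have nb2 : b 2 != 0 by apply: b0; lia.
have nc2 : c 2 != 0 by apply: c0; lia.
have {}e2 : z 2 = - (b 2 / c 2) by apply: (mulfI nc2); rewrite e2; field.
rewrite /beta zval0 zval1 c1.
have -> : 1 * z 3 / (1 * z 2) * (b 2 * c 3 / 1) = b 2 / z 2 * (c 3 * z 3).
  by field.
by rewrite e3 e2; field; rewrite nc2 nb2.
Qed.

(** Serves to compare the [es i.+2] components of [A p_{i+3}(A) v]. *)
Lemma gamma_beta i : (i.+3 < D)%N -> gamma i.+1 * beta i = b i.+4 * gamma i.
Proof.
move=> hi; rewrite !gammaE ?(ltnW hi) // /beta.
by field; rewrite !zval_neq0 ?c0 //; lia.
Qed.

(** Serves to compare the [es i.+3] components of [A p_{i+2}(A) v]. *)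
Lemma betaS i : (i.+3 < D)%N ->
  beta i.+1 = b i.+3 + c i.+3 * gamma i.+1 - c i.+1 * gamma i.
Proof.
move=> hi; rewrite !gammaE ?(ltnW hi) // /beta.
have n1 : c i.+1 != 0 by apply: c0; lia.
have n2 : c i.+2 != 0 by apply: c0; lia.
have n3 : c i.+3 != 0 by apply: c0; lia.
have m2 : z i.+2 != 0 by apply: zval_neq0; lia.
have m3 : z i.+3 != 0 by apply: zval_neq0; lia.
(* Both sides are [z i.+1 * z i.+3] for odd [i] and 0 for even [i]; the claim is a multiple of this
   identity. *)
have e : z i.+1 * (c i.+4 * z i.+4 + b i.+4 * z i.+2) =
         z i.+3 * (c i.+2 * z i.+2 + b i.+2 * z i).
  rewrite !zval_rec ?(ltnW hi) //=; last by lia.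
  by rewrite negbK; case: (odd i); ring.
apply/eqP; rewrite -subr_eq0; apply/eqP.
transitivity (b i.+3 / (c i.+2 * z i.+2 * z i.+3) *
  (z i.+1 * (c i.+4 * z i.+4 + b i.+4 * z i.+2) -
   z i.+3 * (c i.+2 * z i.+2 + b i.+2 * z i))); last by rewrite e subrr mulr0.
by field; rewrite n1 n2 n3 m2 m3.
Qed.

Lemma beta_neq0 i : (i.+3 < D)%N -> beta i != 0.
Proof.
move=> hi; rewrite /beta !mulf_neq0 ?invr_eq0 ?mulf_neq0 ?zval_neq0 ?b0 ?c0 //; lia.
Qed.

Lemma beta_last : ~~ odd D -> beta (D - 3) = 0.
Proof.
move=> oD; rewrite /beta (_ : (D - 3).+3 = D); last by lia.
by rewrite zvalD // mulr0 !mul0r.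
Qed.

(** With the factors in [i] alone moved out of the sum, passing to [i.+2] only rescales and adds one
    term. *)
Lemma gpolyE i : gpoly C adj i =
  (knumbb i / z i) *: parity_sum (fun h => (z h / knumbb h) *: p h) i.
Proof.
rewrite /gpoly /parity_sum scaler_sumr; apply: eq_bigr => h _.
rewrite scalerA; congr (_ *: _).
by rewrite -/(z h) -/(z i) -/(knumbb h) -/(knumbb i); ring.
Qed.

Lemma gpoly_diag i : (i.+1 < D)%N -> knumbb i / z i * (z i / knumbb i) = 1.
Proof.
move=> hi; field; rewrite zval_neq0 ?(ltnW hi) //.
by rewrite gt_eqF // knumbb_gt0.
Qed.

Lemma gpoly0 : gpoly C adj 0 = p 0.
Proof. by rewrite gpolyE parity_sum0 scalerA gpoly_diag ?scale1r //; lia. Qed.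

Lemma gpoly1 : gpoly C adj 1 = p 1.
Proof. by rewrite gpolyE parity_sum1 scalerA gpoly_diag ?scale1r //; lia. Qed.

Lemma gpolyS i : (i.+3 < D)%N ->
  gpoly C adj i.+2 = p i.+2 - gamma i *: gpoly C adj i.
Proof.
move=> hi; rewrite !gpolyE parity_sumS scalerDr scalerA gpoly_diag //.
rewrite scale1r -scaleNr scalerA; congr (_ + _ *: _); rewrite /gamma opprK.
have ki : knumbb i != 0 by rewrite gt_eqF // knumbb_gt0 //; lia.
by field; rewrite ki !zval_neq0 //; lia.
Qed.

(** At 0 each term of the inner sum is [z h ^+ 2 / knumbb h], which is positive, so nothing
    cancels. *)
Lemma gpoly_at0 i : (i.+1 < D)%N -> ~~ odd i -> (gpoly C adj i).[0] != 0.
Proof.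
move=> hi oi; rewrite gpolyE hornerZ mulf_neq0 //.
  by rewrite mulf_neq0 ?invr_eq0 ?zval_neq0 ?(ltnW hi) // gt_eqF // knumbb_gt0.
have pos h : (h <= i)%N -> ~~ odd (i - h) -> 0 < ((z h / knumbb h) *: p h).[0].
  move=> hh oh; have oh' : ~~ odd h by rewrite oddB // (negbTE oi) /= in oh.
  have -> : ((z h / knumbb h) *: p h).[0] = ((-1) ^+ h./2 * z h) ^+ 2 / knumbb h.
    have := zvalE h; rewrite (negbTE oh') -horner_coef0 hornerZ => <-.
    by rewrite exprMn sqrr_sign; ring.
  by rewrite divr_gt0 ?knumbb_gt0 ?exprn_gt0 ?zval_sign //; lia.
rewrite /parity_sum horner_sum (bigD1 ord_max) /=; last by rewrite subnn.
rewrite gt_eqF // ltr_wpDr //; last by rewrite pos ?subnn.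
by apply: sumr_ge0 => h /andP [oh _]; rewrite ltW // pos // -ltnS.
Qed.

End Coefficients.

(** * Thin modules with endpoint two *)

Section Adjoint.
Variable C : numClosedFieldType.

Definition adjoint_mx m n (u : 'M[C]_(m, n)) : 'M[C]_(n, m) := (map_mx Num.conj u)^T.

Lemma adjoint_mulmx m n p (u : 'M[C]_(m, n)) (w : 'M[C]_(n, p)) :
  adjoint_mx (u *m w) = adjoint_mx w *m adjoint_mx u.
Proof. by rewrite /adjoint_mx map_mxM trmx_mul. Qed.

Lemma adjoint_mul_eq0 n (u : 'cV[C]_n) : adjoint_mx u *m u = 0 -> u = 0.
Proof.
move=> /matrixP /(_ 0 0); rewrite !mxE => /eqP.
rewrite psumr_eq0 => [/allP h|r _]; last by rewrite !mxE mulrC mul_conjC_ge0.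
apply/colP=> r; have := h r; rewrite mem_index_enum => /(_ isT).
by rewrite !mxE mulrC mul_conjC_eq0 => /eqP.
Qed.

End Adjoint.

Section EndpointTwo.
Variables (C : numClosedFieldType) (X : finType) (adj : rel X).
Hypothesis graphP : bipartite_distance_regular_graph adj.
Variable x : X.

Local Notation D := (diameter adj).
Local Notation b i := ((bnum adj i)%:R : C).
Local Notation c i := ((cnum adj i)%:R : C).
Local Notation A := (distmx C adj 1).
Local Notation A_ i := (distmx C adj i).
Local Notation N i := (parity_sum (distmx C adj) i).
Local Notation dst r s := (dist adj (enum_val r) (enum_val s)).
Local Notation dx r := (dist adj x (enum_val r)).
Local Notation es i := (Estar C adj x i).
Local Notation VX := 'cV[C]_#|X|.
Local Notation gam i := (gamma C adj i).
Local Notation bet i := (beta C adj i).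

Lemma mul_EstarE i (u : VX) r : (es i *m u) r 0 = if dx r == i then u r 0 else 0.
Proof.
rewrite mxE (bigD1 r) //= big1 => [|s ns]; last by rewrite mxE eq_sym (negbTE ns) mul0r.
by rewrite mxE eqxx addr0 /=; case: eqP; rewrite ?mul1r ?mul0r.
Qed.

Lemma mul_EstarEstar i j (u : VX) :
  es i *m (es j *m u) = if i == j then es j *m u else 0.
Proof.
apply/colP=> r; rewrite !mul_EstarE.
have [->|nij] := eqVneq i j; first by rewrite mul_EstarE; case: (dx r == j).
by rewrite mxE; case: eqP => // ->; rewrite (negbTE nij).
Qed.

Lemma Estar_A_Estar i j (u : VX) : i != j.+1 -> j != i.+1 ->
  es i *m (A *m (es j *m u)) = 0.
Proof.
move=> n1 n2; apply/colP=> r; rewrite mul_EstarE [RHS]mxE; case: eqP => // hr.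
rewrite mxE big1 // => s _; rewrite mul_EstarE !mxE.
case: eqP => [d1|_]; last by rewrite mul0r.
case: eqP => hs; last by rewrite mulr0.
rewrite (dist_sym graphP) in d1.
have := dist_neighbor graphP x d1; rewrite (dist_sym graphP _ x) hr hs; lia.
Qed.

Lemma adjoint_A_mul (u w : VX) :
  adjoint_mx (A *m u) *m w = adjoint_mx u *m (A *m w).
Proof.
rewrite adjoint_mulmx -mulmxA; congr (_ *m (_ *m _)).
by apply/matrixP=> r s; rewrite !mxE conjC_nat (dist_sym graphP).
Qed.

Lemma adjoint_Estar_mul i (u w : VX) :
  adjoint_mx (es i *m u) *m w = adjoint_mx u *m (es i *m w).
Proof.
rewrite adjoint_mulmx -mulmxA; congr (_ *m (_ *m _)).
by apply/matrixP=> r s; rewrite !mxE conjC_nat eq_sym; case: eqP => // ->.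
Qed.

Variables (W : {vspace VX}) (v : VX).
Hypothesis W_mod : Tmodule adj x W.
Hypothesis W_endpoint : endpoint adj x W = 2%N.
Hypothesis vW2 : v \in EstarW adj x 2 W.
Hypothesis D_ge4 : (4 <= D)%N.

Let c1 : c 1 = 1. Proof. by rewrite (cnum1 graphP x) //; lia. Qed.

Lemma mem_EstarW i w : w \in W -> es i *m w \in EstarW adj x i W.
Proof. by move=> wW; rewrite -(lfunE (mulmx (es i))) memv_img. Qed.

Lemma thin_colinear i (u w : VX) : thin adj x W -> (i <= D)%N ->
  u \in EstarW adj x i W -> w \in EstarW adj x i W -> u != 0 ->
  exists t, w = t *: u.
Proof.
move=> W_thin hi uW wW u0; apply/vlineP.
suff -> : <[u]>%VS = EstarW adj x i W by [].
by apply/eqP; rewrite eqEdim -memvE uW dim_vline u0 W_thin.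
Qed.

Lemma Estar_below_endpoint i w : (i < 2)%N -> w \in W -> es i *m w = 0.
Proof.
move=> hi wW; have := before_find 0%N (_ : (i < endpoint adj x W)%N).
rewrite W_endpoint nth_iota; last by lia.
move=> /(_ hi) /negbFE /eqP E0.
by apply/eqP; rewrite -memv0 -E0 mem_EstarW.
Qed.

Lemma Estar2_v : es 2 *m v = v.
Proof.
by have /memv_imgP [w wW ->] := vW2; rewrite lfunE /= mul_EstarEstar eqxx.
Qed.

Lemma vW : v \in W.
Proof.
have /memv_imgP [w wW ->] := vW2; rewrite lfunE.
by apply: W_mod => //; apply: Talg_Estar; lia.
Qed.

Lemma v_support s : dx s != 2 -> v s 0 = 0.
Proof. by rewrite -Estar2_v mul_EstarE => /negbTE ->. Qed.

(** * Entries and components of the vectors [p_i(A) v] *)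

Local Notation pv i := (N i *m v).

Lemma A_pv i : (i.+2 <= D)%N -> A *m pv i.+1 = c i.+2 *: pv i.+2 + b i.+2 *: pv i.
Proof.
by move=> hi; rewrite mulmxA (mul_parity_distmx C graphP x) // mulmxDl -!scalemxAl.
Qed.

Lemma pv0 : pv 0 = v.
Proof. by rewrite parity_sum0 (distmx0 C graphP) mul1mx. Qed.

Lemma pv1 : pv 1 = A *m v.
Proof. by rewrite parity_sum1. Qed.

Lemma pv_mem i : (i <= D)%N -> pv i \in W.
Proof.
have AW w : w \in W -> A *m w \in W by move=> wW; apply: W_mod => //; apply: Talg_adj.
suff [] : ((i <= D)%N -> pv i \in W) /\ ((i.+1 <= D)%N -> pv i.+1 \in W) by [].
elim: i => [|i [IH1 IH2]]; last split=> // hi.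
  by rewrite pv0 pv1; split=> _; rewrite ?AW ?vW.
have cn := natr_c_neq0 C graphP x (hi : 0 < i.+2 <= D)%N.
have /esym/(canRL (addrK _))/(canRL (scalerK cn)) -> := A_pv hi.
by rewrite memvZ // memvB ?memvZ ?AW ?IH2 ?IH1 //; lia.
Qed.

(** All of [v] lies at distance 2 from [x], so this sum is the entry of [p_2(A) v] at [x]; it
    vanishes since [es 0] kills [W]. *)
Lemma sum_v : \sum_s v s 0 = 0.
Proof.
have h2 : (2 <= D)%N by lia.
have := Estar_below_endpoint (isT : 0 < 2)%N (pv_mem h2).
move=> /colP /(_ (enum_rank x)); rewrite mul_EstarE enum_rankK (dist_eq0 graphP) eqxx.
rewrite !mxE => e; rewrite -[RHS]e; apply: eq_bigr => s _.
rewrite parity_distmxE enum_rankK.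
have [->|/v_support ->] := eqVneq (dx s) 2%N; last by rewrite mulr0.
by rewrite mul1r.
Qed.

(** The entry at [r] adds the [v s 0] with [dst r s] at most [i] and of the parity of [i]; on the
    support of [v], [dst r s] differs from [dx r] by at most 2 and has its parity. *)
Lemma pvE i r : (pv i) r 0 =
  if dx r == i.+2 then (A_ i *m v) r 0 else if dx r == i then (pv i) r 0 else 0.
Proof.
case: eqP => [hr|h1].
  rewrite !mxE; apply: eq_bigr => s _; rewrite parity_distmxE mxE.
  have [hs|/v_support ->] := eqVneq (dx s) 2%N; last by rewrite !mulr0.
  have := dist_triangle graphP (enum_val s) x (enum_val r).
  rewrite hr hs (dist_sym graphP (enum_val s)) => tri.
  congr (_ %:R * _); congr nat_of_bool.
  have [->|ne] := eqVneq (dst r s) i; first by rewrite leqnn subnn.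
  by rewrite (_ : (_ <= _)%N = false) //; lia.
case: eqP => // h2; rewrite mxE.
have tri (s : 'I_#|X|) : dx s = 2%N ->
    [/\ (dx r <= 2 + dst r s)%N, (dst r s <= dx r + 2)%N
    & odd (dst r s) = odd (dx r)].
  move=> hs; split.
  - have := dist_triangle graphP (enum_val s) x (enum_val r).
    by rewrite hs (dist_sym graphP (enum_val s)).
  - have := dist_triangle graphP x (enum_val r) (enum_val s).
    by rewrite hs (dist_sym graphP (enum_val r) x).
  by rewrite (odd_dist graphP x) hs addbF (dist_sym graphP).
(* In the first case [dx r] is at most [i - 2], so the whole support counts and the entry is the sum
   of [v]; in the second no vertex of the support counts. *)
have [/andP [le_i oi]|far] := boolP ((dx r <= i)%N && ~~ odd (i - dx r)).
  apply: etrans sum_v; apply: eq_bigr => s _; rewrite parity_distmxE.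
  have [hs|/v_support ->] := eqVneq (dx s) 2%N; last by rewrite mulr0.
  have [t1 t2 t3] := tri s hs; have le_s : (dst r s <= i)%N by lia.
  by rewrite le_s oddB // t3 -oddB // oi mul1r.
apply: big1 => s _; rewrite parity_distmxE.
have [hs|/v_support ->] := eqVneq (dx s) 2%N; last by rewrite mulr0.
have [t1 t2 t3] := tri s hs.
have [le_s|_] := leqP (dst r s) i; last by rewrite mul0r.
by rewrite oddB // t3 (_ : ~~ _ = false) ?mul0r //; lia.
Qed.

(** For given [i] only [l = i.+2] and [l = i] can give nonzero vectors, denoted [V i] and [U i]. *)
Definition component (l i : nat) : VX := es l *m pv i.
Local Notation V i := (component i.+2 i).
Local Notation U i := (component i i).

Lemma component_distmx i : V i = es i.+2 *m (A_ i *m v).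
Proof.
by apply/colP=> r; rewrite !mul_EstarE; case: eqP => // h; rewrite pvE h eqxx.
Qed.

Lemma component_eq0 l i : l != i -> l != i.+2 -> component l i = 0.
Proof.
move=> h1 h2; apply/colP=> r; rewrite mul_EstarE [RHS]mxE; case: eqP => // h.
by rewrite pvE h (negbTE h1) (negbTE h2).
Qed.

Lemma pv_split i : pv i = V i + U i.
Proof.
apply/colP=> r; rewrite [RHS]mxE !mul_EstarE pvE.
case: eqP => h1; case: eqP => h2; rewrite ?addr0 ?add0r //; first by lia.
Qed.

Lemma component_mem l i : (i <= D)%N -> component l i \in EstarW adj x l W.
Proof. by move=> hi; rewrite mem_EstarW // pv_mem. Qed.

Lemma Estar_component l i : es l *m component l i = component l i.
Proof. by rewrite /component mul_EstarEstar eqxx. Qed.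

Lemma Estar_A_pv l i : (i.+2 <= D)%N ->
  es l *m (A *m pv i.+1) = c i.+2 *: component l i.+2 + b i.+2 *: component l i.
Proof. by move=> hi; rewrite A_pv // mulmxDr -!scalemxAr. Qed.

(** One step from [U i] does not reach distance [i + 3], so [V i] may be replaced by [p_i(A) v], to
    which the recurrence applies. *)
Lemma Estar_A_component i : (i.+1 <= D)%N ->
  es i.+3 *m (A *m V i) = c i.+1 *: V i.+1.
Proof.
move=> hi; transitivity (es i.+3 *m (A *m pv i)).
  by rewrite [in RHS]pv_split !mulmxDr [X in _ + X]Estar_A_Estar ?addr0 //; lia.
case: i hi => [|i] hi; first by rewrite pv0 -pv1 c1 scale1r.
by rewrite Estar_A_pv // [component _ i]component_eq0 ?scaler0 ?addr0 //; lia.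
Qed.

Lemma component20 : V 0 = v.
Proof. by rewrite /component pv0 Estar2_v. Qed.

(** * The recursion in a thin module *)

Hypothesis W_thin : thin adj x W.
Hypothesis v_neq0 : v != 0.
Hypothesis v_local : es 2 *m (A_ 2 *m v) = (b 3 - 1) *: v.

Lemma component_rec i : (i.+2 < D)%N ->
  [/\ U i.+2 = gam i *: V i,
      es i.+2 *m (A *m V i.+1) = bet i *: V i & V i != 0].
Proof.
elim: i => [|i IH] hi.
  (* [p_2(A)] is [A_ 2] plus the identity, which turns [b 3 - 1] into [b 3]. *)
  have U2 : U 2 = b 3 *: v.
    rewrite /component parity_sumS parity_sum0 (distmx0 C graphP) mulmxDl mul1mx.
    by rewrite mulmxDr v_local Estar2_v -[X in _ + X]scale1r -scalerDl subrK.
  rewrite (gamma0 C graphP x) // (beta0 C graphP x) // component20; split=> //.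
  have -> : V 1 = pv 1.
    by rewrite pv_split [component 1 1]Estar_below_endpoint ?addr0 // pv_mem //; lia.
  rewrite Estar_A_pv; last by lia.
  by rewrite U2 component20 scalerA -scalerDl addrC.
have [U_i AV_i V_i0] := IH (ltnW hi).
have V_i1 : V i.+1 != 0.
  apply: contraNneq V_i0 => e; move: AV_i; rewrite e !mulmx0 => /esym/eqP.
  by rewrite scaler_eq0 (negbTE (beta_neq0 C graphP x _ hi)).
have [t U_i1] : exists t, U i.+3 = t *: V i.+1.
  by apply: (@thin_colinear i.+3) => //; rewrite ?component_mem //; lia.
(* The [es i.+2] component of [A p_{i+3}(A) v] is found twice, by splitting and by the recurrence;
   [gamma_beta] then lets [bet i] cancel. *)
have tE : t = gam i.+1.
  have : es i.+2 *m (A *m pv i.+3) = (t * bet i) *: V i.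
    rewrite pv_split !mulmxDr [X in X + _]Estar_A_Estar ?add0r; try lia.
    by rewrite U_i1 -!scalemxAr AV_i scalerA.
  rewrite Estar_A_pv // [component _ i.+4]component_eq0 ?scaler0 ?add0r; try lia.
  rewrite U_i scalerA -(gamma_beta C graphP x) // => /eqP.
  rewrite -subr_eq0 -scalerBl scaler_eq0 (negbTE V_i0) orbF subr_eq0 => /eqP.
  by move=> e; apply: (mulIf (beta_neq0 C graphP x D_ge4 hi)).
rewrite tE in U_i1; split=> //.
(* Set against the recurrence, this splitting gives the multiplier of [V i.+1] in the form of
   [betaS]. *)
have : es i.+3 *m (A *m pv i.+2) =
    es i.+3 *m (A *m V i.+2) + (gam i * c i.+1) *: V i.+1.
  rewrite {1}pv_split !mulmxDr U_i -!scalemxAr Estar_A_component ?scalerA //; lia.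
rewrite Estar_A_pv; last by lia.
move=> /esym/(canRL (addrK _)) ->; rewrite U_i1 scalerA -scalerDl -scalerBl.
by congr (_ *: _); rewrite (betaS C graphP x) //; ring.
Qed.

(** As [A] is self-adjoint, [c m.+1] times the squared norm of [V m.+1] is the pairing of
    [A *m V m.+1] with [V m]. That involves only the component at distance [m + 2], which is 0 by
    [beta_last]. *)
Lemma component_last : ~~ odd D -> V (D - 2) = 0.
Proof.
move=> oD; pose m := (D - 3)%N.
have e1 : (D - 2 = m.+1)%N by rewrite /m; lia.
have hm : (m.+2 < D)%N by rewrite /m; lia.
have [_ AV _] := component_rec hm.
rewrite (beta_last C graphP x) // scale0r in AV.
rewrite e1; apply: adjoint_mul_eq0.
have cn : c m.+1 != 0 by apply: (natr_c_neq0 C graphP x); lia.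
apply: (scalerI cn); rewrite scaler0 scalemxAr -Estar_A_component; last by lia.
rewrite -adjoint_Estar_mul Estar_component -adjoint_A_mul -[X in _ *m X]Estar_component.
by rewrite -adjoint_Estar_mul AV /adjoint_mx map_mx0 trmx0 mul0mx.
Qed.

(** * Expansion in the eigenspaces *)

Variables (theta : nat -> C) (E : nat -> 'M[C]_#|X|).
Hypothesis theta_eig : ordered_eigenvalues adj theta.
Hypothesis E_prim :
  forall i : nat, (i <= D)%N -> primitive_idempotent_for adj (theta i) (E i).

Lemma pv_spectral i : (i <= D)%N ->
  pv i = \sum_(j < D.+1) (ppoly C adj i).[theta j] *: (E j *m v).
Proof.
move=> hi; rewrite -[v in LHS]mul1mx -(sum_E graphP theta_eig E_prim).
rewrite [X in _ *m X]mulmx_suml mulmx_sumr; apply: eq_bigr => j _.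
have hj : (j <= D)%N by rewrite -ltnS.
by rewrite mulmxA (mul_parity_E graphP x E_prim) // -scalemxAl.
Qed.

(** Removing [U i.+2 = gam i *: V i] from [p_{i+2}(A) v] leaves [V i.+2], in step with [gpolyS]; at
    the start [U 0] and [U 1] lie below the endpoint. *)
Lemma component_spectral i : (i.+1 < D)%N ->
  V i = \sum_(j < D.+1) (gpoly C adj i).[theta j] *: (E j *m v).
Proof.
suff [] : ((i.+1 < D)%N ->
    V i = \sum_(j < D.+1) (gpoly C adj i).[theta j] *: (E j *m v)) /\
  ((i.+2 < D)%N ->
    V i.+1 = \sum_(j < D.+1) (gpoly C adj i.+1).[theta j] *: (E j *m v)) by [].
elim: i => [|i [IH1 IH2]]; last split=> // hi.
  rewrite (gpoly0 C graphP x) // (gpoly1 C graphP x) // -!pv_spectral; try lia.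
  rewrite [pv 0]pv_split [pv 1]pv_split; split=> _; last first.
    by rewrite [component 1 1]Estar_below_endpoint ?addr0 // pv_mem //; lia.
  by rewrite [component 0 0]Estar_below_endpoint ?addr0 // pv_mem //; lia.
have [U_i _ _] := component_rec (ltnW hi).
have -> : V i.+2 = pv i.+2 - gam i *: V i by rewrite pv_split U_i addrK.
rewrite pv_spectral ?IH1; try lia; rewrite scaler_sumr -sumrB; apply: eq_bigr => j _.
by rewrite (gpolyS C graphP x) // scalerA -scalerBl hornerD hornerN hornerZ.
Qed.

Lemma E_middle_v : ~~ odd D -> theta D./2 = 0 -> E D./2 *m v = 0.
Proof.
move=> oD th0; have hd : (D./2 < D.+1)%N by lia.
have hg : ((D - 2).+1 < D)%N by lia.
have := component_spectral hg; rewrite component_last // => /(congr1 (mulmx (E D./2))).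
rewrite mulmx0 mulmx_sumr (bigD1 (Ordinal hd)) //= big1 => [|j nj]; last first.
  have hj : (j <= D)%N by rewrite -ltnS.
  rewrite -scalemxAr mulmxA (mulEE graphP theta_eig E_prim) //.
  by rewrite eq_sym (negbTE nj : (val j == D./2) = false) mul0mx scaler0.
rewrite addr0 -scalemxAr mulmxA (mulEE graphP theta_eig E_prim) // eqxx th0.
move=> /esym/eqP; rewrite scaler_eq0 (negbTE (gpoly_at0 C graphP x _ _ _)) //; try lia.
by move/eqP.
Qed.

End EndpointTwo.

(** * Assembly of the stated expansion *)

Unset Implicit Arguments.

Theorem theorem14p7 (C : numClosedFieldType) (X : finType) (adj : rel X)
    (D d : nat) (theta : nat -> C) (E : nat -> 'M[C]_#|X|)
    (x : X) (W : {vspace 'cV[C]_#|X|}) (v : 'cV[C]_#|X|) :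
  bipartite_distance_regular_graph adj ->
  diameter adj = D ->
  (4 <= D)%N ->
  ~~ odd D ->
  (3 <= valency adj)%N ->
  d = D./2 ->
  ordered_eigenvalues adj theta ->
  (forall i : nat, (i <= D)%N -> primitive_idempotent_for adj (theta i) (E i)) ->
  irreducible_Tmodule adj x W ->
  thin adj x W ->
  endpoint adj x W = 2%N ->
  local_eigenvalue adj x W (theta_tilde adj (theta d)) ->
  v \in EstarW adj x 2 W ->
  v != 0 ->
  forall i : nat, (i <= D - 3)%N ->
    Estar C adj x (i + 2) *m distmx C adj i *m v
    = \sum_(1 <= j < D | j != d) (gpoly C adj i).[theta j] *: (E j *m v).
Proof.
move=> graphP DE D4 oD _ dE theta_eig E_prim [W_mod _ _] W_thin W_end
  [w [wW2 w0 w_loc]] vW2 v0 i hi; subst D d.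
set D := diameter adj in D4 oD E_prim hi w_loc *.
(* As [D - d = d], the symmetry of the spectrum gives [theta d = - theta d]. *)
have th0 : theta D./2 = 0.
  have hd : (D./2 <= D)%N by lia.
  have := theta_sub graphP x theta_eig hd; rewrite -/D.
  rewrite (_ : (D - D./2 = D./2)%N); last by lia.
  by move/eqP; rewrite -addr_eq0 -mulr2n mulrn_eq0 /= => /eqP.
(* The eigenvalue is given on some [w], of which [v] is a multiple by thinness; at [theta d = 0] it
   equals [-1 + b 3]. *)
have v_loc : Estar C adj x 2 *m (distmx C adj 2 *m v) = ((bnum adj 3)%:R - 1) *: v.
  have h2 : (2 <= D)%N by lia.
  have [t vt] := thin_colinear W_thin h2 wW2 vW2 w0.
  have ww : Estar C adj x 2 *m w = w by apply: (Estar2_v wW2).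
  have b2 : (bnum adj 2)%:R != 0 :> C by apply: (natr_b_neq0 C graphP x); lia.
  rewrite -!mulmxA ww th0 in w_loc.
  rewrite vt -!scalemxAr w_loc !scalerA mulrC; congr (_ * _ *: _).
  by rewrite /theta_tilde; field.
have vS := v_support vW2.
have E0 : E 0 *m v = 0.
  apply: (E0_mul graphP x theta_eig E_prim).
  exact: (sum_v graphP W_mod W_end vW2 D4).
have ED : E D *m v = 0.
  apply: (ED_mul graphP (x := x) theta_eig E_prim).
  apply: etrans (sum_v graphP W_mod W_end vW2 D4); apply: eq_bigr => s _.
  (* The sign is 1 at distance 2, where [v] is supported, so the signed sum equals the plain one. *)
  rewrite /parity_sign; have [->|/vS ->] := eqVneq (dist adj x (enum_val s)) 2%N.
    by rewrite sqrrN expr1n mul1r.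
  by rewrite mulr0.
have Ed : E D./2 *m v = 0.
  exact: (E_middle_v graphP W_mod W_end vW2 D4 W_thin v0 v_loc theta_eig E_prim).
have hi' : (i.+1 < D)%N by lia.
have := component_spectral graphP W_mod W_end vW2 D4 W_thin v0 v_loc
  theta_eig E_prim hi'.
rewrite (component_distmx graphP W_mod W_end vW2 D4) addn2 mulmxA => ->.
rewrite -(big_mkord xpredT (fun j => (gpoly C adj i).[theta j] *: (E j *m v))).
(* The terms [j = D] and [j = 0] are split off and vanish, and so does the term [j = d]. *)
rewrite big_nat_recr //= ED scaler0 addr0 big_ltn ?E0 ?scaler0 ?add0r; last by lia.
rewrite [RHS]big_mkcond; apply: eq_bigr => j _.
by case: eqP => // ->; rewrite Ed scaler0.
Qed.
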